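(* The Frobenius norm of $\widetilde{\mathcal{M}}_n$ satisfies $$\|\widetilde{\mathcal{M}}_n\|_F = O(\sqrt{n}\,\log n)\qquad (n\to\infty).$$
   Context: For an integer $n\ge 1$ let $\mathcal{S}_n=\{\lfloor n/k\rfloor : 1\le k\le n\}$ be the set of distinct integers of this form, let $s=s(n)=\#\mathcal{S}_n$, and list the elements of $\mathcal{S}_n$ in increasing order as $1=k_1<k_2<\cdots<k_s=n$. $T=T_s$ is the $s\times s$ matrix with $T_{ij}=1$ if $i+j\le s+1$ and $T_{ij}=0$ otherwise. $D=\mathrm{diag}(d_1,\dots,d_s)$ is the diagonal matrix with $d_i=\sqrt{n}/k_i$. Set $\widetilde{\mathcal{U}}_n := DTD$ (an invertible $s\times s$ matrix) and $\widetilde{\mathcal{M}}_n := T\,(\widetilde{\mathcal{U}}_n)^{-1}\,T$. The Frobenius norm of an $s\times s$ matrix $A$ is given by $\|A\|_F^2=\sum_{i=1}^s\sum_{j=1}^s |A_{ij}|^2$. *)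

(* Defs.v *)
From HB Require Import structures.
From mathcomp Require Import all_boot all_order all_algebra perm.
From mathcomp Require Import zify.
From mathcomp Require Import all_classical all_reals all_analysis.

Set Implicit Arguments.
Unset Strict Implicit.
Unset Printing Implicit Defensive.

Import Order.TTheory GRing.Theory Num.Theory.
Import numFieldNormedType.Exports.

Local Open Scope ring_scope.

Definition floor_seq (n : nat) : seq nat :=
  sort leq (undup [seq (n %/ k)%N | k <- iota 1 n]).

Definition floor_card (n : nat) : nat := size (floor_seq n).

(* Indices are shifted by one: [floor_val i] is k_(i+1). *)
Definition floor_val (n : nat) (i : 'I_(floor_card n)) : nat :=
  nth 0%N (floor_seq n) i.

(* With indices starting at 0 the condition i + j <= s + 1 becomes i + j < s. *)
Definition Tmx (R : realType) (s : nat) : 'M[R]_s :=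
  \matrix_(i < s, j < s) (if (i + j < s)%N then 1 else 0).

Definition Dmx (R : realType) (n : nat) : 'M[R]_(floor_card n) :=
  diag_mx (\row_(i < floor_card n) (Num.sqrt n%:R / (floor_val i)%:R)).

Definition tildeU (R : realType) (n : nat) : 'M[R]_(floor_card n) :=
  Dmx R n *m Tmx R (floor_card n) *m Dmx R n.

Definition tildeM (R : realType) (n : nat) : 'M[R]_(floor_card n) :=
  Tmx R (floor_card n) *m invmx (tildeU R n) *m Tmx R (floor_card n).

(* The library's norm on matrices is the maximum norm, hence this definition. *)
Definition frobenius_norm (R : realType) (m n : nat) (A : 'M[R]_(m, n)) : R :=
  Num.sqrt (\sum_(i < m) \sum_(j < n) `|A i j| ^+ 2).

Lemma mem_floor_seq (n m : nat) :
  reflect (exists2 k, (1 <= k <= n)%N & m = (n %/ k)%N) (m \in floor_seq n).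
Proof.
rewrite /floor_seq mem_sort mem_undup.
apply: (iffP mapP) => -[k].
  by rewrite mem_iota add1n ltnS => hk ->; exists k.
by move=> hk ->; exists k => //; rewrite mem_iota add1n ltnS.
Qed.

Lemma floor_seq_sorted (n : nat) : sorted ltn (floor_seq n).
Proof.
by rewrite ltn_sorted_uniq_leq sort_uniq undup_uniq sort_sorted //; exact: leq_total.
Qed.

Lemma floor_val_gt0 (n : nat) (i : 'I_(floor_card n)) : (0 < floor_val i)%N.
Proof.
have : floor_val i \in floor_seq n by rewrite mem_nth.
move=> /mem_floor_seq [k /andP[k0 kn] ->].
by rewrite divn_gt0.
Qed.

Lemma Tmx_unit (R : realType) (s : nat) : Tmx R s \in unitmx.
Proof.
pose p : {perm 'I_s} := perm (@rev_ord_inj s).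
have trig : is_trig_mx (row_perm p (Tmx R s)).
  apply/is_trig_mxP => i j ij; rewrite !mxE permE /=.
  case: ifP => // h; exfalso; move: h ij (ltn_ord i) (ltn_ord j).
  by lia.
have : row_perm p (Tmx R s) \in unitmx.
  rewrite unitmxE det_trig // rpred_prod // => i _; rewrite !mxE permE /=.
  have -> : (s - i.+1 + i < s)%N by have := ltn_ord i; lia.
  by rewrite unitr1.
by rewrite row_permE unitmx_mul => /andP[].
Qed.

Lemma tildeU_unit (R : realType) (n : nat) : tildeU R n \in unitmx.
Proof.
have DU : Dmx R n \in unitmx.
  rewrite unitmxE det_diag unitfE; apply/prodf_neq0 => i _; rewrite mxE.
  have n0 : (0 < n)%N by case: n i => [[]|].
  by rewrite mulf_neq0 ?invr_eq0 ?pnatr_eq0 -?lt0n ?floor_val_gt0 //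
     gt_eqF // sqrtr_gt0 ltr0n.
by rewrite /tildeU !unitmx_mul DU Tmx_unit.
Qed.

(* Main.v *)
Require Import Defs.
From mathcomp Require Import all_boot all_order all_algebra.
From mathcomp Require Import all_classical all_reals all_analysis.
From mathcomp Require Import zify ring lra.

Import Order.TTheory GRing.Theory Num.Theory.
Import numFieldNormedType.Exports.

Local Open Scope classical_set_scope.
Local Open Scope ring_scope.

(** The matrix has at most $4n$ entries, each of size $O(\log n)$; that
    pointwise bound is the heart of the matter.

    Write $k_0 < \dots < k_{s-1}$ for the distinct values $\lfloor n/k\rfloor$.
    The inverse of $T$ is supported on two neighbouring antidiagonals, so
    the inverse of $DTD$ has entries $k_i k_j / n$ with sign $+$ where
    $i + j = s - 1$ and $-$ where $i + j = s$.  Multiplying by $T$ on both sides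
    sums these entries over a corner (tildeM_entry).  Pairing the two
    antidiagonals row by row, with
    $f_i = k_i k_{s-1-i}/n$ and $g_i = k_i k_{s-i}/n$, an entry in column $b$
    is at most $f_b + \sum_{1 \le i < s} (g_i - f_i)$ in absolute value.

    The division $m \mapsto \lfloor n/m\rfloor$ is an order-reversing involution
    of the set of the $k_i$, whence $k_i k_{s-1-i} \le n$
    (nth_floor_seq_dual).  Thus $f_b \le 1$, and with $x = k_{s-1-i}$ and
    its successor $y = k_{s-i}$ one gets
    $g_i - f_i \le (y - x)/x$.  As $y \le 3x$ (nth_floor_seqS_le), this
    relative gap is at most $3(\ln y - \ln x)$ and the sum telescopes to
    at most $3 \ln n$ (sum_floor_gap_le).  Hence every entry is at most
    $1 + 3\ln n$ (tildeM_entry_le).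

    The same duality gives $s^2 \le 4n$ (floor_card_sqr), since $k_i > i$.  The
    Frobenius norm is at most $s$ times the largest entry, that is
    $O(\sqrt n \ln n)$. *)

(** * The floor values and their duality *)

Lemma floor_seq_bounds (n m : nat) : m \in floor_seq n -> (0 < m <= n)%N.
Proof.
move=> /mem_floor_seq[k /andP[k0 kn] ->].
by rewrite divn_gt0 // kn leq_div.
Qed.

(** For $q = \lfloor n/k\rfloor$, the number $\lfloor n/q\rfloor$ is the
    largest $j$ with $\lfloor n/j\rfloor = q$; in particular it is at
    least $k$. *)
Lemma divn_divn_floor_seq (n m : nat) :
  m \in floor_seq n -> (n %/ (n %/ m))%N = m.
Proof.
move=> /mem_floor_seq[k /andP[k0 kn] ->].
set q := (n %/ k)%N.
have q0 : (0 < q)%N by rewrite divn_gt0.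
have kq : (k <= n %/ q)%N by rewrite leq_divRL // mulnC leq_divM.
apply/eqP; rewrite eqn_leq; apply/andP; split.
  by rewrite /q leq_div2l.
by rewrite leq_divRL ?(leq_trans k0) // mulnC leq_divM.
Qed.

Lemma floor_seq_divn (n m : nat) :
  m \in floor_seq n -> (n %/ m)%N \in floor_seq n.
Proof. by move=> /floor_seq_bounds mn; apply/mem_floor_seq; exists m. Qed.

(** Division of $n$ is an involution that strictly reverses the order, and a
    finite chain has only one such map; comparing two strictly increasing
    sequences with the same members expresses this uniqueness. *)
Lemma rev_floor_seq (n : nat) :
  rev [seq (n %/ m)%N | m <- floor_seq n] = floor_seq n.
Proof.
apply: (irr_sorted_eq ltn_trans ltnn) => [||x].
- rewrite rev_sorted; apply: (@homo_sorted_in _ _ (mem (floor_seq n))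
    (divn n) ltn (fun x y => (y < x)%N)) => //.
  + move=> x y xS yS /= xy; rewrite ltn_neqAle leq_div2l ?(ltnW xy) ?andbT //.
      apply: contraTN xy => /eqP e.
      by rewrite -(divn_divn_floor_seq n x) // -(divn_divn_floor_seq n y) // e ltnn.
    by case/andP: (floor_seq_bounds _ _ xS).
  + exact: floor_seq_sorted.
- exact: floor_seq_sorted.
- rewrite mem_rev; apply/mapP/idP => [[m mS ->]|xS]; first exact: floor_seq_divn.
  by exists (n %/ x)%N; [exact: floor_seq_divn | rewrite divn_divn_floor_seq].
Qed.

Lemma nth_floor_seq_rev (n i : nat) : (i < floor_card n)%N ->
  nth 0%N (floor_seq n) (floor_card n - i.+1) = (n %/ nth 0%N (floor_seq n) i)%N.
Proof.
move=> i_s.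
rewrite -{1}rev_floor_seq nth_rev size_map -/(floor_card n); last by lia.
rewrite (nth_map 0%N) -/(floor_card n); last by lia.
by congr (_ %/ nth _ _ _)%N; lia.
Qed.

Lemma nth_floor_seq_bounds (n i : nat) : (i < floor_card n)%N ->
  (0 < nth 0%N (floor_seq n) i <= n)%N.
Proof. by move=> i_s; apply: floor_seq_bounds; rewrite mem_nth. Qed.

Lemma nth_floor_seq_mono (n i j : nat) : (i < j < floor_card n)%N ->
  (nth 0%N (floor_seq n) i < nth 0%N (floor_seq n) j)%N.
Proof.
move=> /andP[ij js].
have i_s := ltn_trans ij js.
by apply: (sorted_ltn_nth ltn_trans 0%N (floor_seq_sorted n)).
Qed.

(** This bounds by 1 the positive antidiagonal of the inverse of tildeU. *)
Lemma nth_floor_seq_dual (n i : nat) : (i < floor_card n)%N ->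
  (nth 0%N (floor_seq n) i * nth 0%N (floor_seq n) (floor_card n - i.+1) <= n)%N.
Proof. by move=> i_s; rewrite nth_floor_seq_rev // mulnC leq_divM. Qed.

Lemma ltn_nth_floor_seq_index (n i : nat) : (i < floor_card n)%N ->
  (i < nth 0%N (floor_seq n) i)%N.
Proof.
elim: i => [|i IH] i_s; first by case/andP: (nth_floor_seq_bounds _ _ i_s).
apply: leq_ltn_trans (IH _) (nth_floor_seq_mono _ _ _ _); first exact: ltnW.
by rewrite leqnn.
Qed.

(** The duality bound at the middle index: there both factors are at least
    $s/2$, because the values are strictly increasing and start at 1. *)
Lemma floor_card_sqr (n : nat) : (floor_card n ^ 2 <= 4 * n)%N.
Proof.
set s := floor_card n; have [->//|s0] := posnP s.
pose i := (s.-1./2)%N.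
have is_ : (i < s)%N by rewrite /i; lia.
have h1 := ltn_nth_floor_seq_index n i is_.
have h2 : (s - i.+1 < nth 0%N (floor_seq n) (s - i.+1))%N.
  by apply: ltn_nth_floor_seq_index; rewrite -/s; lia.
have h := leq_trans (leq_mul h1 h2) (nth_floor_seq_dual n i is_).
(* i is the lower middle index, so s is 2i + 1 or 2i + 2. *)
have /orP[/eqP e|/eqP e] : (s == i.*2.+1) || (s == i.*2.+2) by rewrite /i; lia.
all: by move: h; rewrite e; nia.
Qed.

(** The successor of $m$ cannot be far away: with
    $k = \lfloor n/(m+1)\rfloor$ the value $\lfloor n/k\rfloor$ exceeds $m$,
    and $n < (k+1)(m+1) \le 2k(m+1)$ keeps it at most $2m + 1 \le 3m$. *)
Lemma nth_floor_seqS_le (n i : nat) : (i.+1 < floor_card n)%N ->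
  (nth 0%N (floor_seq n) i.+1 <= 3 * nth 0%N (floor_seq n) i)%N.
Proof.
move=> i_s; set m := nth 0%N (floor_seq n) i.
have im : (i < floor_card n)%N by exact: ltnW.
have /andP[m0 mn] : (0 < m <= n)%N by exact: nth_floor_seq_bounds.
have mn1 : (m < n)%N.
  have /andP[_] := nth_floor_seq_bounds _ _ i_s; apply: leq_trans.
  by apply: nth_floor_seq_mono; rewrite leqnn.
pose k := (n %/ m.+1)%N.
have k0 : (0 < k)%N by rewrite divn_gt0.
have kn : (k <= n)%N by rewrite leq_div.
have mS : (n %/ k)%N \in floor_seq n.
  by apply/mem_floor_seq; exists k; rewrite ?k0.
have mk : (m < n %/ k)%N by rewrite leq_divRL // mulnC leq_divM.
have km : (n %/ k <= 3 * m)%N.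
  have : (n %/ k < 2 * m.+1)%N.
    rewrite ltn_divLR //; apply: leq_trans (ltn_ceil n (ltn0Sn m)) _.
    by rewrite -/k mulnAC leq_mul2r mul2n -addnn -[k.+1]addn1 leq_add2l k0 orbT.
  lia.
apply: leq_trans km; rewrite leqNgt; apply/negP => lt.
move: mk lt; rewrite -(nth_index 0%N mS).
have : (index (n %/ k)%N (floor_seq n) < floor_card n)%N by rewrite index_mem.
set j := index _ _ => js.
have [ji|] := leqP j i.
  have [->|ne] := eqVneq j i; first by rewrite ltnn.
  have := nth_floor_seq_mono n j i; rewrite im ltn_neqAle ne ji => /(_ isT).
  by move=> ji_lt ij_lt; move: (ltn_trans ji_lt ij_lt); rewrite ltnn.
rewrite leq_eqVlt => /orP[/eqP <-|ij _]; first by rewrite ltnn.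
have := nth_floor_seq_mono n i.+1 j; rewrite ij js => /(_ isT) lt1 lt2.
by move: (ltn_trans lt1 lt2); rewrite ltnn.
Qed.

(** * The entries of tildeM *)

(** A row of the inverse of $T$, paired with an arbitrary vector $c$; row 0 meets
    only one of the two antidiagonals, hence the factor $0 < i$. *)
Lemma sum_antidiag (R : realType) (s i : nat) (c : nat -> R) : (i < s)%N ->
  \sum_(j < s) c j * ((i + j.+1 == s)%N%:R - (i + j == s)%N%:R)
  = c (s - i.+1)%N - (0 < i)%N%:R * c (s - i)%N.
Proof.
move=> i_s; under eq_bigr do rewrite mulrBr.
rewrite sumrB; congr (_ - _).
  have h : (s - i.+1 < s)%N by lia.
  rewrite (bigD1 (Ordinal h)) //= big1 => [|j].
    by rewrite (_ : (_ == _) = true) ?mulr1 ?addr0 //; lia.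
  rewrite -val_eqE /= => jh.
  by rewrite (_ : (_ == _) = false) ?mulr0 //; lia.
case: i i_s => [|i] i_s.
  rewrite mul0r big1 // => j _; rewrite (_ : (_ == _) = false) ?mulr0 //.
  by have := ltn_ord j; lia.
have h : (s - i.+1 < s)%N by lia.
rewrite (bigD1 (Ordinal h)) //= big1 => [|j].
  by rewrite (_ : (_ == _) = true) ?mul1r ?mulr1 ?addr0 //; lia.
rewrite -val_eqE /= => jh.
by rewrite (_ : (_ == _) = false) ?mulr0 //; lia.
Qed.

(** These two equivalences identify which corners of $T$ the two antidiagonals
    meet: column $b$ sees the first from row $b$ on, the second strictly
    below. *)
Lemma ltn_antidiag (s i b : nat) :
  (i < s)%N -> (s - i.+1 + b < s)%N = (b <= i)%N.
Proof. by lia. Qed.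

Lemma ltn_antidiagS (s i b : nat) :
  (i < s)%N -> ((0 < i) && (s - i + b < s))%N = (b < i)%N.
Proof. by lia. Qed.

Definition Tmx_inv (R : realType) (s : nat) : 'M[R]_s :=
  \matrix_(i < s, j < s) ((i + j.+1 == s)%N%:R - (i + j == s)%N%:R).

Lemma Tmx_inv_mulK (R : realType) (s : nat) : Tmx_inv R s *m Tmx R s = 1%:M.
Proof.
apply/matrixP => i b; rewrite !mxE.
transitivity (\sum_(j < s) (j + b < s)%N%:R *
    ((i + j.+1 == s)%N%:R - (i + j == s)%N%:R) : R).
  by apply: eq_bigr => j _; rewrite !mxE mulrC; case: ifP.
rewrite (@sum_antidiag R s i (fun j => (j + b < s)%N%:R)) //.
rewrite -natrM mulnb -val_eqE /=.
rewrite ltn_antidiag // ltn_antidiagS //.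
by case: (ltngtP b i) => _; rewrite ?subrr ?subr0.
Qed.

(** Since the inverse of $D$ is the diagonal matrix of the $k_i/\sqrt n$, the
    square root disappears from the inverse of $DTD$. *)
Lemma invmx_tildeU (R : realType) (n : nat) (i j : 'I_(floor_card n)) :
  invmx (tildeU R n) i j = (floor_val i)%:R * (floor_val j)%:R / n%:R *
    ((i + j.+1 == floor_card n)%N%:R - (i + j == floor_card n)%N%:R).
Proof.
have n0 : (0 < n)%N by case: n i {j} => [[]|].
have sn0 : Num.sqrt n%:R != 0 :> R by rewrite gt_eqF // sqrtr_gt0 ltr0n.
pose E : 'M[R]_(floor_card n) :=
  diag_mx (\row_(i < floor_card n) ((floor_val i)%:R / Num.sqrt n%:R)).
have ED : E *m Dmx R n = 1%:M.
  rewrite /E /Dmx mulmx_diag; apply/matrixP => a b; rewrite !mxE.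
  congr (_ *+ _).
  have : (floor_val a)%:R != 0 :> R by rewrite pnatr_eq0 -lt0n floor_val_gt0.
  by move=> ?; field; apply/andP.
have VU : (E *m Tmx_inv R _ *m E) *m tildeU R n = 1%:M.
  rewrite /tildeU -!mulmxA (mulmxA E (Dmx R n)) ED mul1mx.
  by rewrite (mulmxA _ (Tmx _ _)) Tmx_inv_mulK mul1mx.
have -> : invmx (tildeU R n) = E *m Tmx_inv R _ *m E.
  by rewrite -[RHS]mulmx1 -(mulmxV (tildeU_unit R n)) mulmxA VU mul1mx.
rewrite mul_mx_diag mul_diag_mx !mxE.
rewrite [in RHS](_ : n%:R = Num.sqrt n%:R * Num.sqrt n%:R :> R); last first.
  by rewrite -expr2 sqr_sqrtr // ler0n.
by field.
Qed.

Definition floor_elt (R : realType) (n i : nat) : R :=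
  (nth 0%N (floor_seq n) i)%:R.

(** The two antidiagonals are kept in one summand, row by row: the sum over one
    antidiagonal alone is only bounded by its length, while the paired
    differences sum to a logarithm. *)
Lemma tildeM_entry (R : realType) (n : nat) (a b : 'I_(floor_card n)) :
  tildeM R n a b = \sum_(i < floor_card n | (a + i < floor_card n)%N)
    ((b <= i)%N%:R * (floor_elt R n i * floor_elt R n (floor_card n - i.+1) / n%:R)
     - (b < i)%N%:R * (floor_elt R n i * floor_elt R n (floor_card n - i) / n%:R)).
Proof.
set s := floor_card n.
rewrite /tildeM -mulmxA mxE [RHS]big_mkcond /=; apply: eq_bigr => i _.
rewrite !mxE -/s; case: ifP => _; last by rewrite mul0r.
rewrite mul1r.
transitivity (\sum_(j < s)
    (floor_elt R n i * floor_elt R n j / n%:R * (j + b < s)%N%:R) *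
    ((i + j.+1 == s)%N%:R - (i + j == s)%N%:R)).
  apply: eq_bigr => j _; rewrite invmx_tildeU !mxE mulrAC -/s.
  by congr (_ * _ * _); case: ifP.
rewrite (@sum_antidiag R s i
  (fun j => floor_elt R n i * floor_elt R n j / n%:R * (j + b < s)%N%:R)) //.
have i_s : (i < s)%N := ltn_ord i.
by rewrite ltn_antidiag // -(ltn_antidiagS s i b i_s) -mulnb natrM; ring.
Qed.

(** * The logarithmic bound on the entries *)

(** From $\ln(y/x) \ge 1 - x/y = (y-x)/y$; replacing $y$ by $3x$ in the
    denominator costs the factor 3. *)
Lemma relative_gap_le_ln (R : realType) (x y : R) :
  0 < x -> x <= y <= 3 * x -> (y - x) / x <= 3 * (ln y - ln x).
Proof.
move=> x0 /andP[xy y3x]; have y0 : 0 < y by exact: lt_le_trans xy.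
have lnxy : ln x - ln y <= x / y - 1.
  rewrite -ln_div ?posrE //.
  have -> : x / y = 1 + (x / y - 1) by ring.
  rewrite [in leRHS]addrAC subrr add0r; apply: le_ln1Dx.
  by have : 0 < x / y by [exact: divr_gt0]; lra.
have gap : (y - x) / x <= 3 * (1 - x / y).
  rewrite ler_pdivrMr //.
  have -> : 3 * (1 - x / y) * x = (y - x) * (3 * x / y).
    by field; rewrite gt_eqF.
  by rewrite ler_peMr ?subr_ge0 // ler_pdivlMr // mul1r.
lra.
Qed.

(** Since $k_i \le n/k_{s-1-i}$, the difference of the neighbouring entries is at
    most the relative gap between the consecutive values $k_{s-1-i}$ and
    $k_{s-i}$. *)
Lemma floor_gap_bounds (R : realType) (n i : nat) :
  (0 < i < floor_card n)%N ->
  0 <= floor_elt R n i * floor_elt R n (floor_card n - i) / n%:R -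
       floor_elt R n i * floor_elt R n (floor_card n - i.+1) / n%:R
    <= 3 * (ln (floor_elt R n (floor_card n - i)) -
            ln (floor_elt R n (floor_card n - i.+1))).
Proof.
set s := floor_card n => /andP[i0 i_s].
have jS : (s - i = (s - i.+1).+1)%N by lia.
have js : ((s - i.+1).+1 < s)%N by lia.
have := nth_floor_seq_dual n i i_s; rewrite -/s.
have := nth_floor_seqS_le n _ js.
have := nth_floor_seq_mono n (s - i.+1) (s - i.+1).+1; rewrite leqnn js => /(_ isT).
have /andP[] := nth_floor_seq_bounds n (s - i.+1)%N (ltnW js).
have /andP[+ _] := nth_floor_seq_bounds n i i_s.
rewrite jS /floor_elt.
move: (nth _ _ i) (nth _ _ (_ - _)%N) (nth _ _ _.+1) => k x y k0 x0 xn xy y3x kx.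
have n0 : 0 < n%:R :> R by rewrite ltr0n (leq_trans x0).
have x0R : 0 < x%:R :> R by rewrite ltr0n.
have xyR : x%:R <= y%:R :> R by rewrite ler_nat ltnW.
rewrite -mulrBl -mulrBr; apply/andP; split.
  by rewrite divr_ge0 ?mulr_ge0 ?subr_ge0 // ler0n.
apply: le_trans (relative_gap_le_ln _ _ _ x0R _); last first.
  by rewrite xyR -natrM ler_nat.
rewrite ler_pdivrMr // mulrAC ler_pdivlMr // mulrAC mulrC.
by rewrite ler_wpM2l ?subr_ge0 // -natrM ler_nat.
Qed.

(** The logarithms telescope to $\ln k_{s-1} - \ln k_0$. *)
Lemma sum_floor_gap_le (R : realType) (n : nat) : (0 < n)%N ->
  \sum_(1 <= i < floor_card n)
    (floor_elt R n i * floor_elt R n (floor_card n - i) / n%:R -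
     floor_elt R n i * floor_elt R n (floor_card n - i.+1) / n%:R) <= 3 * ln n%:R.
Proof.
set s := floor_card n => n0.
have lnn0 : 0 <= ln n%:R :> R by rewrite ln_ge0 // ler1n.
have [s1|s1] := ltnP s 1%N; first by rewrite big_geq ?mulr_ge0 // ltnW.
apply: le_trans (_ : \sum_(1 <= i < s)
    3 * (- ln (floor_elt R n (s - i.+1)) - - ln (floor_elt R n (s - i))) <= _).
  rewrite big_nat [leRHS]big_nat; apply: ler_sum => i ih.
  by have /andP[_] := floor_gap_bounds R n i ih; rewrite opprK [- _ + _]addrC.
rewrite -mulr_sumr ler_wpM2l //.
rewrite (telescope_sumr (fun i => - ln (floor_elt R n (s - i)))) // opprK subnn.
have ge1 i : (i < s)%N -> 1 <= floor_elt R n i <= n%:R.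
  by move=> /nth_floor_seq_bounds; rewrite ler1n ler_nat.
have /andP[k1 _] := ge1 0%N s1.
have /andP[l1 ln_] : 1 <= floor_elt R n (s - 1) <= n%:R by apply: ge1; lia.
have := ln_ge0 k1.
have : ln (floor_elt R n (s - 1)) <= ln n%:R.
  by rewrite ler_ln ?posrE // ?(lt_le_trans ltr01 l1) // ltr0n.
lra.
Qed.

(** In tildeM_entry the row $i = b$ contributes a single antidiagonal term, at most
    1 by duality, and later rows contribute differences of fixed sign, so the sum
    may be extended to all positive rows. *)
Lemma tildeM_entry_le (R : realType) (n : nat) (a b : 'I_(floor_card n)) :
  `|tildeM R n a b| <= 1 + 3 * ln n%:R.
Proof.
have n0 : (0 < n)%N by case: n a {b} => [[]|].
have nR0 : 0 < n%:R :> R by rewrite ltr0n.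
rewrite tildeM_entry; set s := floor_card n.
pose f i := floor_elt R n i * floor_elt R n (s - i.+1) / n%:R.
pose g i := floor_elt R n i * floor_elt R n (s - i) / n%:R.
have f0 i : 0 <= f i by rewrite divr_ge0 ?mulr_ge0 ?ler0n.
have fg (i : nat) : (0 < i < s)%N -> 0 <= g i - f i.
  by move=> /(floor_gap_bounds R n)/andP[].
apply: le_trans (ler_norm_sum _ _ _) _.
apply: le_trans (_ : \sum_(i < s)
    ((i == b)%:R * f i + (0 < i)%N%:R * (g i - f i)) <= _).
  rewrite big_mkcond; apply: ler_sum => i _ /=.
  have i_s := ltn_ord i.
  have gf : 0 <= (0 < i)%N%:R * (g i - f i).
    by case: posnP => [_|i0]; rewrite ?mul0r // mul1r fg // i0.
  case: ifP => [_|_]; last by apply: addr_ge0 => //; apply: mulr_ge0.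
  rewrite -/(f i) -/(g i) -val_eqE /=.
  case: ltngtP => bi; rewrite ?mul0r ?mul1r ?subrr ?subr0 ?normr0 ?add0r //.
    have i0 : (0 < i)%N by exact: leq_ltn_trans bi.
    by rewrite i0 mul1r distrC ger0_norm // fg // i0.
  by rewrite ger0_norm // lerDl.
rewrite big_split /=; apply: lerD.
  rewrite (bigD1 b) //= big1 => [|i /negbTE->]; last by rewrite mul0r.
  rewrite eqxx mul1r addr0 ler_pdivrMr // mul1r -natrM ler_nat.
  exact: nth_floor_seq_dual.
apply: le_trans (sum_floor_gap_le R n n0).
rewrite -(big_mkord xpredT (fun i => (0 < i)%N%:R * (g i - f i))).
have s0 : (0 < s)%N by exact: leq_ltn_trans (ltn_ord a).
rewrite big_ltn // mul0r add0r big_nat [leRHS]big_nat.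
by apply: ler_sum => i /andP[i0 _]; rewrite i0 mul1r.
Qed.

(** * The Frobenius norm *)

Lemma frobenius_norm_le (R : realType) (m n : nat) (A : 'M[R]_(m, n)) (B : R) :
  0 <= B -> (forall i j, `|A i j| <= B) ->
  frobenius_norm A <= Num.sqrt (m * n)%N%:R * B.
Proof.
move=> B0 AB; rewrite -[X in _ * X](ger0_norm B0) -sqrtr_sqr -sqrtrM ?ler0n //.
rewrite ler_sqrt ?mulr_ge0 ?sqr_ge0 ?ler0n //.
apply: le_trans (_ : \sum_(i < m) \sum_(j < n) B ^+ 2 <= _).
  by apply: ler_sum => i _; apply: ler_sum => j _; rewrite ler_sqr ?nnegrE.
under eq_bigr do rewrite sumr_const card_ord.
by rewrite sumr_const card_ord -mulrnA mulr_natl mulnC.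
Qed.

Theorem corollary6p5 (R : realType) :
  (fun n : nat => frobenius_norm (tildeM R n) : R^o) =O_\oo
  (fun n : nat => Num.sqrt n%:R * ln n%:R : R^o).
Proof.
(* 12 = 2 * 6: s <= 2 sqrt n, and 1 + 3 ln n <= 6 ln n once ln n >= 1/3. *)
apply/eqO_exP; exists 12 => //; near=> n.
have n2 : (2 <= n)%N by near: n; exact: nbhs_infty_ge.
have ln2 : 1 / 3 <= ln n%:R :> R.
  apply: le_trans (_ : ln 2 <= _); last first.
    by rewrite ler_ln ?posrE ?ltr0n ?(ltnW n2) // ler_nat.
  (* ln 2 >= 1/3 is the relative gap bound for the pair 1, 2. *)
  have := relative_gap_le_ln R 1 2 ltr01; rewrite ln1; lra.
have B0 : 0 <= 1 + 3 * ln n%:R :> R by lra.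
rewrite [leLHS]ger0_norm ?sqrtr_ge0 // [X in 12 * X]ger0_norm; last first.
  by rewrite mulr_ge0 ?sqrtr_ge0 //; lra.
apply: le_trans (frobenius_norm_le _ _ _ _ _ B0 (@tildeM_entry_le R n)) _.
rewrite mulnn.
apply: le_trans (_ : Num.sqrt (4 * n)%N%:R * (6 * ln n%:R) <= _).
  apply: ler_pM => //.
    by rewrite ler_sqrt ?ler0n // ler_nat floor_card_sqr.
  lra.
rewrite natrM sqrtrM ?ler0n // (_ : 4%:R = 2 ^+ 2) ?sqrtr_sqr; last by ring.
by rewrite ger0_norm //; lra.
Unshelve. all: by end_near.
Qed.
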